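(* Let $T$ be any countable weakly $2$-transitive tree (all of whose maximal chains are isomorphic to $\mathbb{Q}$ and which has incomparable points), and let $U_T$ be the set of atoms of the associated Fraenkel--Mostowski model $\mathfrak{N}_T$. Then $|U_T|\in\Delta_5$ in $\mathfrak{N}_T$, and if $T$ has infinitely many ramification orders, then $|U_T|\notin\Delta_4$ in $\mathfrak{N}_T$.
   Context: Cardinal classes. $\Delta_4$ is the class of cardinalities of sets $X$ having no surjection onto $\omega$. $\Delta_5$ is the class of cardinalities of sets $X$ having no surjection to a proper superset of $X$ (equivalently, every surjection $X\to X$ is injective). Trees. A tree is a partially ordered set $(T,\le)$ in which any two elements have a common lower bound and $\{y\in T:y\le x\}$ is linearly ordered for every $x\in T$. A tree is weakly $2$-transitive if for any two $2$-element chains there is an automorphism of $T$ taking the first to the second. Non-triviality is assumed throughout: all maximal chains of $T$ are isomorphic to $\mathbb{Q}$, and there are incomparable points. $T^+$ is the least lower semilattice (tree in which any two elements have a greatest lower bound, or meet, $\wedge$) extending $T$; it is obtained from $T$ by adjoining points so that any two members of $T$ have a meet, and all new points have the form $a\wedge b$ with $a,b\in T$. A ramification point is a member of $T^+$ which is the meet of two incomparable members of $T$. At a ramification point $x$ there is an equivalence relation on the points above $x$: $y\sim z$ if for some $t>x$, $y,z\ge t$. The equivalence classes are the cones at $x$, and the number of cones is the ramification order of $x$. Fraenkel--Mostowski models. FMC is ZFC modified to allow a set $U$ of atoms (objects with no elements, distinct from $\emptyset$), with extensionality restricted to non-atoms. Given a ground model $\mathfrak{M}$ of FMC with set of atoms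 $U$ and a group $G\in\mathfrak{M}$ of permutations of $U$, let $G$ act on $\mathfrak{M}$ by $g(x)=\{g(y):y\in x\}$; write $G_{\{x\}}=\{g\in G:g(x)=x\}$ and $G_x=\{g\in G: g(y)=y \text{ for all } y\in x\}$. The finite support filter $\mathfrak{F}$ is the family of subgroups of $G$ containing $G_A$ for some finite $A\subseteq U$, and the model determined by $G$ with finite supports is $\mathfrak{N}=\{x\in\mathfrak{M}: G_{\{x\}}\in\mathfrak{F}\wedge x\subseteq\mathfrak{N}\}$ (defined by transfinite induction). For the tree $T$, the ground model has set of atoms $U_T=\{u_t:t\in T\}$ indexed by $T$, $G$ is the group of permutations of $U_T$ induced by the automorphism group of $T$, and $\mathfrak{N}_T$ is the resulting model with finite supports. *)

(* Defs.v *)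
From mathcomp Require Import all_boot all_order all_algebra.
From mathcomp Require Import boolp classical_sets functions cardinality.

Set Implicit Arguments.
Unset Strict Implicit.
Unset Printing Implicit Defensive.

Import Order.TTheory.
Local Open Scope card_scope.
Local Open Scope order_scope.
Local Open Scope classical_set_scope.

Section Trees.
Context {d : Order.disp_t} (T : porderType d).
Implicit Types (t a b : T) (C : set T) (X Y Z : set T).

Definition down t : set T := [set s | s <= t].

Definition is_chain C : Prop := total_on C (fun x y => x <= y).

Definition is_tree : Prop :=
  (forall x y : T, exists z, z <= x /\ z <= y) /\
  (forall x : T, is_chain (down x)).

Definition maximal_chain C : Prop :=
  is_chain C /\ forall D : set T, is_chain D -> C `<=` D -> D = C.

Definition iso_rat C : Prop :=
  exists f : T -> rat, set_bij C [set: rat] f /\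
    forall x y, C x -> C y -> (f x <= f y)%R = (x <= y).

Definition automorphism : set (T -> T) :=
  [set f | bijective f /\ {mono f : x y / x <= y}].

(* A 2-element chain is a pair x < y; an automorphism, preserving the order,
   takes {x < y} to {x' < y'} iff it maps x to x' and y to y'. *)
Definition weakly_2_transitive : Prop :=
  forall x y x' y' : T, x < y -> x' < y' ->
    exists f, [/\ automorphism f, f x = x' & f y = y'].

Definition nontrivial_tree : Prop :=
  (forall C, maximal_chain C -> iso_rat C) /\ (exists a b, a >< b).

(* T^+ is realised inside the completion of T by lower sets: T is identified
   with its principal lower sets, the order is inclusion, meets are
   intersections, and T^+ is the least family containing T and closed under
   binary meets. [TplusP] below shows that, for a tree, its members are exactly
   the meets of two members of T. *)
Definition Tplus : set (set T) := smallest (@setI_closed T) (range down).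

Definition ramification_point X : Prop :=
  Tplus X /\ exists a b, a >< b /\ X = down a `&` down b.

Definition above X : set (set T) :=
  [set Y | Tplus Y /\ (X `<=` Y /\ X <> Y)].

Definition cone_equiv X Y Z : Prop :=
  exists S, [/\ above X S, S `<=` Y & S `<=` Z].

Definition cones X : set (set (set T)) :=
  [set [set Z | above X Z /\ cone_equiv X Y Z] | Y in above X].

(* Cardinals of sets of cones are represented by equipotence classes. *)
Definition ramification_order X : set (set (set (set T))) :=
  [set K | K #= cones X].

Definition ramification_orders : set (set (set (set (set T)))) :=
  [set ramification_order X | X in ramification_point].

Lemma TplusP : is_tree ->
  Tplus = [set X | exists a b, X = down a `&` down b].
Proof.
move=> [_ lin]; apply/seteqP; split => X.
- move=> /(_ [set X | exists a b, X = down a `&` down b]); apply.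
  split; last by move=> _ [a _ <-]; exists a, a; rewrite setIid.
  (* lower sets of a chain are nested, so the meet of two meets is one of the
     meets of [a] with [b], [c] or [e] *)
  have nest a b c : down a `&` down b `<=` down a `&` down c \/
                    down a `&` down c `<=` down a `&` down b.
    case: (pselect (down a `&` down b `<=` down a `&` down c)); first by left.
    move=> /existsNP [s /not_implyP [[sa sb] nsc]]; right => r [ra rc].
    split=> //; have [rs|sr] := lin a r s ra sa.
      exact: le_trans rs sb.
    by case: nsc; split=> //; exact: le_trans sr rc.
  have min2 a b c : exists e, down a `&` down b `&` down c = down a `&` down e.
    have [h|h] := nest a b c.
      exists b; apply/seteqP; split; first by move=> s [].
      by move=> s ab; split => //; have [] := h _ ab.
    exists c; apply/seteqP; split; first by move=> s [[? _] ?].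
    by move=> s ac; split; [exact: h|case: ac].
  move=> _ _ [a [b ->]] [c [e ->]].
  have [u Eu] := min2 a b c; have [v Ev] := min2 a u e.
  by exists a, v; rewrite setIA Eu Ev.
- move=> [a [b ->]] F [FI Fd].
  by apply: FI; apply: Fd; [exists a|exists b].
Qed.

End Trees.

Arguments automorphism {d} T.
Arguments Tplus {d} T.
Arguments ramification_orders {d} T.

(* The cumulative hierarchy over a set of atoms indexed by A: a non-atom is
   presented by a family of members, and presentations are compared by
   extensional equality [ext_eq]. *)
Inductive fmc (A : Type) : Type :=
| Atom of A
| Coll (K : Type) of (K -> fmc A).

Fixpoint ext_eq (A : Type) (x y : fmc A) {struct x} : Prop :=
  match x, y with
  | Atom a, Atom b => a = b
  | Coll K f, Coll L h => (forall i, exists j, ext_eq (f i) (h j)) /\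
                          (forall j, exists i, ext_eq (f i) (h j))
  | _, _ => False
  end.

Definition mem_fmc (A : Type) (x y : fmc A) : Prop :=
  if y is Coll K f then exists i, ext_eq x (f i) else False.

Definition is_atom (A : Type) (x : fmc A) : Prop := exists a, x = Atom a.

Definition atoms (A : Type) : fmc A := Coll (@Atom A).

Fixpoint act (A : Type) (g : A -> A) (x : fmc A) : fmc A :=
  match x with
  | Atom a => Atom (g a)
  | Coll K f => Coll (fun i => act g (f i))
  end.

Definition perm_group (A : Type) (G : set (A -> A)) : Prop :=
  [/\ forall g, G g -> bijective g,
      G id,
      forall g h, G g -> G h -> G (g \o h) &
      forall g h, G g -> cancel g h -> cancel h g -> G h].

Section PermutationModel.
Variables (A : Type) (G : set (A -> A)).

Definition stabiliser (x : fmc A) : set (A -> A) :=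
  [set g | G g /\ ext_eq (act g x) x].

Definition fixator (E : set A) : set (A -> A) :=
  [set g | G g /\ forall a, E a -> g a = a].

Definition finite_support_filter (H : set (A -> A)) : Prop :=
  [/\ perm_group H, H `<=` G & exists2 E, finite_set E & fixator E `<=` H].

Inductive in_model (x : fmc A) : Prop :=
  InModel of finite_support_filter (stabiliser x) &
    (forall y, mem_fmc y x -> in_model y).

End PermutationModel.

Lemma ext_eq_refl A (x : fmc A) : ext_eq x x.
Proof. by elim: x => [//|I f IH] /=; split=> i; exists i. Qed.

Lemma ext_eq_sym A (x y : fmc A) : ext_eq x y -> ext_eq y x.
Proof.
elim: x y => [a|I f IH] [b|J h] //= [fh hf]; split=> [j|i].
  by have [i /IH] := hf j; exists i.
by have [j /IH] := fh i; exists j.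
Qed.

Lemma ext_eq_trans A (x y z : fmc A) : ext_eq x y -> ext_eq y z -> ext_eq x z.
Proof.
elim: x y z => [a|I f IH] [b|J h] [c|K k] //=; first by move=> ->.
move=> [fh hf] [hk kh]; split=> [i|l].
  by have [j e1] := fh i; have [l e2] := hk j; exists l; exact: IH e1 e2.
by have [j e2] := kh l; have [i e1] := hf j; exists i; exact: IH e1 e2.
Qed.

Lemma ext_eq_act A (g : A -> A) (x y : fmc A) :
  ext_eq x y -> ext_eq (act g x) (act g y).
Proof.
elim: x y => [a|I f IH] [b|J h] //=; first by move=> ->.
move=> [fh hf]; split=> [i|j].
  by have [j e] := fh i; exists j; exact: IH.
by have [i e] := hf j; exists i; exact: IH.
Qed.

Lemma act_comp A (g h : A -> A) (x : fmc A) : act (g \o h) x = act g (act h x).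
Proof.
by elim: x => [//|I f IH] /=; congr Coll; apply: funext => i; exact: IH.
Qed.

Lemma act_id A (x : fmc A) : act id x = x.
Proof.
by elim: x => [//|I f IH] /=; congr Coll; apply: funext => i; exact: IH.
Qed.

Lemma stabiliser_group A (G : set (A -> A)) (x : fmc A) :
  perm_group G -> perm_group (stabiliser G x).
Proof.
move=> [bij G1 GM GV]; split.
- by move=> g [/bij].
- by split=> //; rewrite act_id; exact: ext_eq_refl.
- move=> g h [Gg gx] [Gh hx]; split; first exact: GM.
  by rewrite act_comp; exact: ext_eq_trans (ext_eq_act g hx) gx.
- move=> g h [Gg gx] gh hg; split; first exact: GV gh hg.
  have /ext_eq_sym := ext_eq_act h gx.
  by rewrite -act_comp (_ : h \o g = id) ?act_id //; apply: funext.
Qed.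

Lemma atom_in_model A (G : set (A -> A)) (a : A) :
  perm_group G -> in_model G (Atom a).
Proof.
move=> gG; split=> //; split; [exact: stabiliser_group|by move=> g []|].
by exists [set a]; [exact: finite_set1|move=> g [Gg ga]; split=> //=; exact: ga].
Qed.

Lemma atoms_in_model A (G : set (A -> A)) :
  perm_group G -> in_model G (atoms A).
Proof.
move=> gG; split; last first.
  case=> [b|K f] [a] //= ->; exact: atom_in_model.
split; [exact: stabiliser_group|by move=> g []|].
exists set0; first exact: finite_set0.
move=> g [Gg _]; split=> //=; have [bij _ _ _] := gG.
have [h gh hg] := bij _ Gg.
by split=> i; [exists (g i)|exists (h i); rewrite hg].
Qed.

Lemma automorphism_group d (T : porderType d) : perm_group (automorphism T).
Proof.
split.
- by move=> g [].
- by split=> //; exists id.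
- move=> g h [bg mg] [bh mh]; split; first exact: bij_comp.
  by move=> x y /=; rewrite mg mh.
- move=> g h [bg mg] gh hg; split; first by exists g.
  by move=> x y; rewrite -mg !hg.
Qed.

(* A structure for the language of set theory with atoms. All quantifiers below
   range over its carrier, so each notion is the one of the structure. *)
Record fm_structure := FMStructure {
  fm_sort :> Type;
  fm_eq : fm_sort -> fm_sort -> Prop;
  fm_mem : fm_sort -> fm_sort -> Prop;
  fm_atom : fm_sort -> Prop }.

Section Internal.
Variable M : fm_structure.
Implicit Types x y z u v w p f X Y : M.
Local Notation "x '=m' y" := (fm_eq x y) (at level 70).
Local Notation "x '\inm' y" := (fm_mem x y) (at level 70).

Definition is_empty x : Prop := ~ fm_atom x /\ forall z, ~ z \inm x.

Definition is_succ v x : Prop := forall z, z \inm v <-> z \inm x \/ z =m x.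

Definition is_inductive w : Prop :=
  (exists x, is_empty x /\ x \inm w) /\
  (forall x, x \inm w -> exists v, is_succ v x /\ v \inm w).

Definition is_omega w : Prop :=
  is_inductive w /\
  forall v, is_inductive v -> forall x, x \inm w -> x \inm v.

Definition is_upair p x y : Prop := forall z, z \inm p <-> z =m x \/ z =m y.

Definition is_opair p x y : Prop :=
  exists u v, [/\ is_upair u x x, is_upair v x y & is_upair p u v].

Definition maps f x y : Prop := exists p, is_opair p x y /\ p \inm f.

Definition is_function f X Y : Prop :=
  [/\ ~ fm_atom f,
      forall p, p \inm f -> exists x y, [/\ x \inm X, y \inm Y & is_opair p x y],
      forall x, x \inm X -> exists y, maps f x y &
      forall x y z, maps f x y -> maps f x z -> y =m z].

Definition is_surjection f X Y : Prop :=
  is_function f X Y /\ forall y, y \inm Y -> exists x, x \inm X /\ maps f x y.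

Definition proper_superset Y X : Prop :=
  (forall x, x \inm X -> x \inm Y) /\ exists y, y \inm Y /\ ~ y \inm X.

(* A cardinal |X| belongs to the class Delta_i when X has the defining property,
   which depends only on the equipotence class of X. *)
Definition Delta4 X : Prop :=
  forall w, is_omega w -> ~ exists f, is_surjection f X w.

Definition Delta5 X : Prop :=
  forall Y, proper_superset Y X -> ~ exists f, is_surjection f X Y.

End Internal.

Definition model_of (A : Type) (G : set (A -> A)) : fm_structure :=
  @FMStructure {x : fmc A | in_model G x}
    (fun x y => ext_eq (sval x) (sval y))
    (fun x y => mem_fmc (sval x) (sval y))
    (fun x => is_atom (sval x)).

Definition N_tree d (T : porderType d) : fm_structure :=
  model_of (automorphism T).

Definition U_tree d (T : porderType d) : N_tree T :=
  exist _ (atoms T) (atoms_in_model (automorphism_group T)).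

(* Main.v *)
Require Import Defs.
From mathcomp Require Import all_boot all_order all_algebra.
From mathcomp Require Import boolp classical_sets functions cardinality.

(** A set of the permutation model is invariant under all automorphisms of [T]
    that fix some finite set [E] of points, so a function of the model defined
    on the atoms is equivariant under these automorphisms.

    For Delta5, suppose that such an [f] maps the atoms onto a set that contains
    all atoms and a further element [y0].  Starting from a preimage [u 0] of
    [y0] and choosing [u n.+1] among the preimages of [u n], one gets pairwise
    distinct points, because no [u n] with [n] positive is the point [u 0] that
    goes to [y0].  As [f] is equivariant, an automorphism that fixes [E] and
    [u n] fixes every [u m] with [m <= n].  So Delta5 holds as soon as the number
    of points fixed by all automorphisms fixing [E] and one more point [a] is
    bounded independently of [a] ([Delta5_of_bounded_closure]).

    In the tree, let [x] be a point fixed by every automorphism that fixes all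
    points of the finite list [l].  Weak 2-transitivity provides many
    automorphisms, since automorphisms that agree at a point [t] can be glued:
    one is used above [t], the other elsewhere.  In particular, a point can be
    moved within an interval of [T] by an automorphism that is the identity above
    the top and outside the part above the bottom of the interval.  This forces
    the set of points strictly below [x] to be determined by the meet of two
    points of [l] ([pinned_below]).  The points with the same set of strict lower
    bounds as [x], its siblings, form an antichain; at most one of them lies
    below each point of [l], and if two of them are below no point of [l] they
    can be exchanged by an automorphism fixing [l].  Altogether there are at most
    [n * n * (n + 1)] possible [x] if [l] has [n] points ([pinned_bounded]).
    Such an [x] need not be a meet of points of [l]: it can be the only other
    sibling of a point of [l].

    For the second part, fix a point [a] and send [t] to the ramification order
    of the meet of [t] and [a].  This is invariant under the automorphisms fixing
    [a], and since [T] is transitive every ramification order is taken at a meet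
    with [a].  Composing with a map from the infinite set of orders onto the
    natural numbers gives a surjection in the model from the atoms onto omega. *)

Set Implicit Arguments.
Unset Strict Implicit.
Unset Printing Implicit Defensive.

Import Order.TTheory.

(** * Automorphisms of a tree *)

Section TreeAutomorphisms.
Context {d : Order.disp_t} {T : porderType d}.
Local Open Scope order_scope.
Local Open Scope classical_set_scope.
Local Notation down := Defs.down.
Hypothesis treeT : is_tree T.
Implicit Types (x y z s t q : T) (h k : T -> T) (l : seq T).

Lemma comparable_below x y z : x <= z -> y <= z -> x <= y \/ y <= x.
Proof. by case: treeT => _ lin xz yz; exact: (lin z x y xz yz). Qed.

Definition glue t h k y := if t <= y then k y else h y.

(** Whether a point [y] not above [t] is below a point above [t] depends only on
    whether [y <= t], so that the two halves fit together. *)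
Lemma automorphism_glue t h k : h t = k t ->
  automorphism T h -> automorphism T k -> automorphism T (glue t h k).
Proof.
move=> htk [[h' hK h'K] mh] [[k' kK k'K] mk]; split.
  exists (glue (h t) h' k') => y; rewrite /glue.
    case: (boolP (t <= y)) => [ty|/negPf nty]; first by rewrite htk mk ty kK.
    by rewrite mh nty hK.
  have E : (t <= k' y) = (h t <= y) by rewrite htk -mk k'K.
  have E' : (t <= h' y) = (h t <= y) by rewrite -mh h'K.
  by case: (boolP (h t <= y)) => [ty|/negPf nty]; rewrite ?E ?E' ?ty ?nty ?k'K ?h'K.
move=> y z; rewrite /glue.
case: (boolP (t <= y)) => ty; case: (boolP (t <= z)) => tz //.
  have -> : (y <= z) = false.
    by apply: contraNF tz; exact: le_trans.
  apply: contraNF tz => kyz; rewrite -mh htk.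
  by apply: le_trans kyz; rewrite mk.
apply/idP/idP => yz.
  have ktz : k t <= k z by rewrite mk.
  have [a|a] := comparable_below yz ktz.
    by move: a; rewrite -htk mh => a; exact: le_trans tz.
  by move: a ty; rewrite -htk mh => ->.
have [a|a] := comparable_below yz tz; last by rewrite a in ty.
by apply: (@le_trans _ _ (h t)); rewrite ?mh // htk mk.
Qed.

Definition swap x y h k z :=
  if x <= z then h z else if y <= z then k z else z.

(** Points with the same strict lower bounds are interchangeable together with
    everything above them: [swap] is an involution, and a point under
    something above [x] but not itself above [x] is under [x], hence under [y]. *)
Lemma automorphism_swap x y h k :
  [set z | z < x] = [set z | z < y] -> x <> y ->
  automorphism T h -> automorphism T k -> cancel h k -> cancel k h ->
  h x = y -> automorphism T (swap x y h k).
Proof.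
move=> xy nxy [_ mh] [_ mk] hK kK hx.
have kx : k y = x by rewrite -hx hK.
have ltE z : (z < x) = (z < y).
  have E : (z < x) <-> (z < y).
    by split=> zx; [have: [set z | z < x] z by []; rewrite xy
                   |have: [set z | z < y] z by []; rewrite -xy].
  by apply/idP/idP => /E.
have nle u v z : (forall w, (w < u) = (w < v)) -> u <> v -> u <= z -> v <= z -> False.
  move=> uv nuv uz vz; have [a|a] := comparable_below uz vz.
    move: a; rewrite le_eqVlt => /orP [/eqP //|].
    by rewrite -uv ltxx.
  move: a; rewrite le_eqVlt => /orP [/eqP /esym //|].
  by rewrite uv ltxx.
have excl z : x <= z -> y <= z = false.
  by move=> xz; apply/negP => yz; exact: nle ltE nxy xz yz.
have sK : involutive (swap x y h k).
  move=> z; rewrite /swap; case: (boolP (x <= z)) => xz.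
    have yhz : y <= h z by rewrite -hx mh.
    by case: (boolP (x <= h z)) => [/excl|_]; rewrite yhz // hK.
  case: (boolP (y <= z)) => yz; last by rewrite (negPf xz) (negPf yz).
  by rewrite -kx mk yz kK.
have smono : {homo swap x y h k : z w / z <= w}.
  move=> z w zw; rewrite /swap.
  case: (boolP (x <= z)) => xz; first by rewrite (le_trans xz zw) mh.
  case: (boolP (y <= z)) => yz.
    case: (boolP (x <= w)) => [/excl|_]; first by rewrite (le_trans yz zw).
    by rewrite (le_trans yz zw) mk.
  case: (boolP (x <= w)) => xw.
    have zx : z < x.
      have [a|a] := comparable_below zw xw; last by rewrite a in xz.
      by rewrite lt_neqAle a andbT; apply: contraNneq xz => ->.
    by apply: ltW; apply: (@lt_le_trans _ _ y); rewrite -?ltE // -hx mh.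
  case: (boolP (y <= w)) => yw //.
  have zx : z < y.
    have [a|a] := comparable_below zw yw; last by rewrite a in yz.
    by rewrite lt_neqAle a andbT; apply: contraNneq yz => ->.
  by apply: ltW; apply: (@lt_le_trans _ _ x); rewrite ?ltE // -kx mk.
split; first by exists (swap x y h k).
by move=> z w; apply/idP/idP => [/smono|/smono //]; rewrite !sK.
Qed.

(** Zorn's lemma is applied to the sets whose union with [C] is a chain, instead
    of the chains containing [C], so that the empty union causes no trouble. *)
Lemma maximal_chain_extending C :
  is_chain C -> exists2 D : set T, maximal_chain D & C `<=` D.
Proof.
move=> chC.
pose P (D : set T) := is_chain (C `|` D).
have [|D [PD maxD]] := @Zorn_bigcup T P.
  move=> F FP totF x y; rewrite /P.
  case=> [Cx|[X FX Xx]]; case=> [Cy|[Y FY Yy]].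
  - exact: chC.
  - by apply: (FP Y FY); [left|right].
  - by apply: (FP X FX); [right|left].
  - have [XY|YX] := totF X Y FX FY.
      by apply: (FP Y FY); right=> //; exact: XY.
    by apply: (FP X FX); right=> //; exact: YX.
exists (C `|` D); last by move=> x; left.
split=> // B chB sub; apply: contrapT => neq.
apply: (maxD B).
  split; first by move=> x Dx; apply: sub; right.
  by move=> BD; apply: neq; apply/seteqP; split=> // x /BD; right.
by move=> x y xin yin; apply: chB; [case: xin|case: yin] => // ?; apply: sub; left.
Qed.

Hypothesis chains_rat : forall C : set T, maximal_chain C -> iso_rat C.

Lemma exists_below x : exists s, s < x.
Proof.
have [|D mD sub] := @maximal_chain_extending [set x].
  by move=> ? ? -> ->; left.
have [f [[fD fi fs] fm]] := chains_rat mD.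
have Dx : D x by exact: sub.
have [s Ds fse] := fs (f x - 1)%R I.
exists s; rewrite lt_neqAle -fm // fse.
rewrite GRing.addrC Num.Theory.gerDr ?Num.Theory.lerN10 andbT.
apply/eqP => sx; move: fse; rewrite sx => /eqP.
by rewrite -GRing.subr_eq0 GRing.opprB GRing.addrC GRing.subrK.
Qed.

Lemma exists_between s x : s < x -> exists2 y, s < y & y < x.
Proof.
move=> sx.
have [|D mD sub] := @maximal_chain_extending [set s; x].
  move=> ? ? [] -> [] ->; rewrite ?lexx ?(ltW sx); by [left|right].
have [f [[fD fi fs] fm]] := chains_rat mD.
have Dx : D x by apply: sub; right.
have Ds : D s by apply: sub; left.
have fm' a b : D a -> D b -> (f a < f b)%R = (a < b).
  by move=> Da Db; rewrite !lt_leAnge !fm.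
have fsx : (f s < f x)%R by rewrite fm'.
have [y Dy fy] := fs ((f s + f x) / 2%:R)%R I.
by exists y; rewrite -fm' // fy ?Num.Theory.midf_lt.
Qed.

Hypothesis w2t : weakly_2_transitive T.

Lemma automorphism_transitive x y : exists2 h, automorphism T h & h x = y.
Proof.
have [s sx] := exists_below x; have [s' sy] := exists_below y.
by have [h [ah _ hx]] := w2t sx sy; exists h.
Qed.

Lemma automorphism_inv h k :
  automorphism T h -> cancel h k -> cancel k h -> automorphism T k.
Proof. by case: (automorphism_group T) => _ _ _ inv; exact: inv. Qed.

Lemma automorphism_id : automorphism T id.
Proof. by case: (automorphism_group T). Qed.

(** Gluing with the identity confines the support of an automorphism provided by
    weak 2-transitivity. *)
Lemma move_above s q q' : s < q -> s < q' ->
  exists h, [/\ automorphism T h, h q = q' & forall y, ~ s <= y -> h y = y].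
Proof.
move=> sq sq'; have [h [ah hs hq]] := w2t sq sq'.
exists (glue s id h); split.
- by apply: automorphism_glue => //; exact: automorphism_id.
- by rewrite /glue (ltW sq).
- by move=> y /negP/negPf sy; rewrite /glue sy.
Qed.

Lemma move_between s t q q' : s < q -> s < q' -> q < t -> q' < t ->
  exists h, [/\ automorphism T h, h q = q', (forall y, ~ s <= y -> h y = y)
              & forall y, t <= y -> h y = y].
Proof.
move=> sq sq' qt qt'.
have [h [ah hs hq]] := w2t sq sq'; have [k [ak kq kt]] := w2t qt qt'.
have tq : t <= q = false by apply: lt_geF.
have qs : q <= s = false by apply: lt_geF.
have ag : automorphism T (glue t k id).
  by apply: automorphism_glue => //; exact: automorphism_id.
have ag2 : automorphism T (glue q h (glue t k id)).
  by apply: automorphism_glue => //; rewrite /glue tq kq.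
exists (glue s id (glue q h (glue t k id))); split.
- apply: automorphism_glue => //; first by rewrite /glue qs hs.
  exact: automorphism_id.
- by rewrite /glue (ltW sq) lexx tq.
- by move=> y /negP/negPf sy; rewrite /glue sy.
- move=> y ty; have qy := le_trans (ltW qt) ty.
  by rewrite /glue ty qy (le_trans (ltW sq) qy).
Qed.

(** * Points fixed by a pointwise stabiliser *)

(** In model-theoretic terms, [x] is in the definable closure of [l]. *)
Definition pinned l x := forall h, automorphism T h ->
  (forall f, f \in l -> h f = f) -> h x = x.

(** Each [f] in [l] that fails to lie above all strict lower bounds of [x]
    excludes an initial segment of them; the largest of these finitely many
    excluding points can be taken, since they lie on the chain below [x]. *)
Lemma separating_below l x : exists2 s, s < x &
  forall f, f \in l -> s <= f -> [set y | y < x] `<=` down f.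
Proof.
elim: l => [|f l [s sx IH]]; first by have [s sx] := exists_below x; exists s.
have [cr|ncr] := pselect ([set y | y < x] `<=` down f).
  by exists s => // g; rewrite inE => /orP [/eqP -> //|]; exact: IH.
have /existsNP [r /not_implyP [rx nrf]] := ncr.
have [rs|sr] := comparable_below (ltW rx) (ltW sx).
  exists s => // g; rewrite inE => /orP [/eqP -> sf|]; last exact: IH.
  by case: nrf; exact: le_trans sf.
exists r => // g; rewrite inE => /orP [/eqP -> //|gl rg].
by apply: IH => //; exact: le_trans rg.
Qed.

(** The meets of [f] with other points are initial segments of the chain below
    [f], so finitely many of them have a least one. *)
Lemma least_meet f l : exists2 g, g \in f :: l &
  forall e, e \in f :: l -> down f `&` down g `<=` down e.
Proof.
elim: l => [|e l [g gl IH]].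
  by exists f; rewrite ?mem_head // => e; rewrite inE => /eqP -> y [].
have [sub|nsub] := pselect (down f `&` down g `<=` down e).
  exists g; first by move: gl; rewrite !inE => /orP [->|->]; rewrite ?orbT.
  move=> c; rewrite !inE orbCA => /orP [/eqP -> //|cl].
  by apply: IH; rewrite inE.
have /existsNP [r /not_implyP [[rf rg] nre]] := nsub.
exists e; first by rewrite !inE eqxx orbT.
have le_r y : (down f `&` down e) y -> y <= r.
  move=> [yf ye]; have [//|ry] := comparable_below yf rf.
  by case: nre; exact: le_trans ye.
move=> c; rewrite !inE orbCA => /orP [/eqP -> y [] //|cl] y fey.
apply: IH; first by rewrite inE.
by split; [case: fey|exact: le_trans (le_r _ fey) rg].
Qed.

(** Only the points [f] of [l] above all strict lower bounds of [x] restrict the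
    movement of [x].  If there were none, [x] could be moved down.  Otherwise let
    [L] be the meet of all of them, which is the meet of two of them.  If some
    [q] strictly below a point [t] of [L] were not strictly below [x], then [q]
    could be moved to a point [q'] strictly below [x] by an automorphism fixing
    [l]; it fixes [x], although it does not preserve being strictly below [x].
    The right-hand side consists of the points strictly below some element of
    [L], rather than of [L], because [L] itself may or may not have a greatest
    element. *)
Lemma pinned_below l x : pinned l x -> exists f g, [/\ f \in l, g \in l &
  [set y | y < x] = [set y | exists2 z, (down f `&` down g) z & y < z]].
Proof.
move=> pinx; have [s sx sep] := separating_below l x.
pose K := [seq f <- l | `[< [set y | y < x] `<=` down f >]].
have KP f : f \in K <-> f \in l /\ [set y | y < x] `<=` down f.
  rewrite mem_filter; split=> [/andP [/asboolP]|[? ?]] //.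
  by apply/andP; split=> //; exact/asboolP.
case EK : K => [|f K'].
  (* no point of [l] restricts [x], so [x] can be moved down *)
  have [x' sx' x'x] := exists_between sx.
  have [h [ah hx hfix]] := move_above sx sx'.
  have := pinx h ah; rewrite hx => E; move: x'x; rewrite E ?ltxx // => f fl.
  apply: hfix => sf; have : f \in K by apply/KP; split=> //; exact: sep.
  by rewrite EK.
have [g gK least] := least_meet f K'.
rewrite -EK in gK least; have /KP [fl Xf] : f \in K by rewrite EK mem_head.
have /KP [gl Xg] := gK.
exists f, g; split=> //; apply/seteqP; split=> [y yx|q [t [tf tg] qt]] /=.
  by have [z yz zx] := exists_between yx; exists z => //; split; [exact: Xf|exact: Xg].
apply: contrapT => nqx.
have [q' sq' q'x] := exists_between sx.
have q'q : q' < q.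
  have q'f : q' <= f := Xf _ q'x.
  have qf : q <= f := le_trans (ltW qt) tf.
  have [a|a] := comparable_below q'f qf; last first.
    by case: nqx; exact: le_lt_trans q'x.
  by rewrite lt_neqAle a andbT; apply/eqP => E; apply: nqx; rewrite -E.
have [h [ah hq hs ht]] :=
  move_between (lt_trans sq' q'q) sq' qt (lt_trans q'q qt).
have hx : h x = x.
  apply: pinx => // e el; have [se|nse] := boolP (s <= e); last exact/hs/negP.
  apply: ht; apply: (least e); last by split.
  by apply/KP; split=> //; exact: sep el se.
apply: nqx; have [_ mh] := ah.
by rewrite lt_leAnge -(mh q x) -(mh x q) hq hx -lt_leAnge.
Qed.

Lemma siblings_below_eq f x y : [set z | z < x] = [set z | z < y] ->
  x <= f -> y <= f -> x = y.
Proof.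
move=> xy xf yf; have [a|a] := comparable_below xf yf.
  move: a; rewrite le_eqVlt => /orP [/eqP //|a].
  by have : [set z | z < y] x by []; rewrite -xy /= ltxx.
move: a; rewrite le_eqVlt => /orP [/eqP //|a].
by have : [set z | z < x] y by []; rewrite xy /= ltxx.
Qed.

(** Otherwise [automorphism_swap] exchanges [x] and [y] and fixes [l]. *)
Lemma pinned_sibling_eq l x y : [set z | z < x] = [set z | z < y] ->
  (forall f, f \in l -> ~ x <= f) -> (forall f, f \in l -> ~ y <= f) ->
  pinned l x -> x = y.
Proof.
move=> xy nx ny pinx; apply: contrapT => nxy.
have [h ah hx] := automorphism_transitive x y.
have [k hK kK] : bijective h by case: ah.
have ak := automorphism_inv ah hK kK.
have asw := automorphism_swap xy nxy ah ak hK kK hx.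
apply: nxy; rewrite -(pinx _ asw) /swap ?lexx // => f fl.
by move/negP/negPf: (nx f fl) => ->; move/negP/negPf: (ny f fl) => ->.
Qed.

(** A pinned [x] is determined by the two points of [l] given by [pinned_below]
    and by a point of [l] above [x], if there is one. *)
Lemma pinned_bounded l (u : seq T) : uniq u -> (forall x, x \in u -> pinned l x) ->
  (size u <= size l * size l * (size l).+1)%N.
Proof.
move=> uu pinu.
pose I := 'I_(size l); pose e (i : I) := tnth (in_tuple l) i.
have eP f : f \in l -> exists i, f = e i.
  by move=> fl; have /tnthP [i ->] : f \in in_tuple l by []; exists i.
pose code (x : T) (c : I * I * option I) :=
  [set y | y < x] =
    [set y | exists2 z, (down (e c.1.1) `&` down (e c.1.2)) z & y < z] /\
  if c.2 is Some i then x <= e i else forall f, f \in l -> ~ x <= f.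
have codeP x : x \in u -> exists c, code x c.
  move=> xu; have [f [g [/eP [i ->] /eP [j ->] E]]] := pinned_below (pinu x xu).
  have [[f' fl xf]|nf] := pselect (exists2 f', f' \in l & x <= f').
    by have [m Em] := eP f' fl; exists (i, j, Some m); split; rewrite //= -Em.
  by exists (i, j, None); split=> //= f' fl xf; apply: nf; exists f'.
have code_inj x y c : x \in u -> y \in u -> code x c -> code y c -> x = y.
  move=> xu yu [Ex Ox] [Ey Oy].
  have xy : [set z | z < x] = [set z | z < y] by rewrite Ex Ey.
  case: c.2 Ox Oy => [i xi yi|nx ny]; first exact: siblings_below_eq xy xi yi.
  exact: pinned_sibling_eq xy nx ny (pinu x xu).
have [->//|[x0 x0u]] : u = [::] \/ exists x0, x0 \in u.
  by case: (u) => [|x0 u']; [left|right; exists x0; rewrite mem_head].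
have [c0 _] := codeP x0 x0u.
pose c x := xget c0 (code x).
have cP x : x \in u -> code x (c x) by move=> /codeP [c1 /(xgetI c0)].
have uc : uniq (map c u).
  rewrite map_inj_in_uniq // => x y xu yu E.
  by apply: (code_inj x y (c x)) => //; [exact: cP|rewrite E; exact: cP].
have := max_card (mem (map c u)); rewrite (card_uniqP uc) size_map.
by rewrite card_prod card_prod card_option !card_ord.
Qed.
End TreeAutomorphisms.

(** * Sets of a permutation model *)

Section PermutationModelTheory.
Local Open Scope classical_set_scope.
Variables (A : Type) (G : set (A -> A)).
Hypothesis groupG : perm_group G.
Implicit Types (x y z : fmc A) (g : A -> A).
Local Notation M := (model_of G).

Lemma mem_ext_l x x' y : ext_eq x x' -> mem_fmc x y -> mem_fmc x' y.
Proof.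
case: y => [//|K f] xx' [i xi]; exists i.
exact: ext_eq_trans (ext_eq_sym xx') xi.
Qed.

Lemma mem_ext_r x y y' : ext_eq y y' -> mem_fmc x y -> mem_fmc x y'.
Proof.
case: y y' => [a|K f] [b|L h] //= [fh _] [i xi].
by have [j e] := fh i; exists j; exact: ext_eq_trans xi e.
Qed.

Lemma mem_act g x y : mem_fmc x y -> mem_fmc (act g x) (act g y).
Proof. by case: y => [//|K f] [i xi]; exists i; exact: ext_eq_act. Qed.

Lemma in_model_mem x y : in_model G y -> mem_fmc x y -> in_model G x.
Proof. by case=> _ memy; exact: memy. Qed.

Lemma in_model_support x : in_model G x -> exists2 E : set A,
  finite_set E & forall g, fixator G E g -> ext_eq (act g x) x.
Proof. by case=> [[_ _ [E finE sub]] _]; exists E => // g /sub []. Qed.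

Lemma supported_in_model (E : set A) x : finite_set E ->
  (forall g, fixator G E g -> ext_eq (act g x) x) ->
  (forall y, mem_fmc y x -> in_model G y) -> in_model G x.
Proof.
move=> finE fixE memx; split=> //; split.
- exact: stabiliser_group.
- by move=> g [].
- by exists E => // g gE; split; [case: gE|exact: fixE].
Qed.

Lemma in_model_ext x y : ext_eq x y -> in_model G x -> in_model G y.
Proof.
move=> xy inx; have [E finE fixE] := in_model_support inx.
apply: (supported_in_model finE) => [g gE|z zy].
  exact: ext_eq_trans (ext_eq_act g (ext_eq_sym xy)) (ext_eq_trans (fixE g gE) xy).
exact: in_model_mem inx (mem_ext_r (ext_eq_sym xy) zy).
Qed.

(** Extensionality only needs members in the model, which is transitive. *)
Lemma ext_eqP x y : ~ is_atom x -> ~ is_atom y ->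
  in_model G x -> in_model G y ->
  (forall z, in_model G z -> mem_fmc z x <-> mem_fmc z y) -> ext_eq x y.
Proof.
case: x => [a na|K f _]; first by case: na; exists a.
case: y => [a na|L h _ inf inh E]; first by case: na; exists a.
have memi i : mem_fmc (f i) (Coll f) by exists i; exact: ext_eq_refl.
have memj j : mem_fmc (h j) (Coll h) by exists j; exact: ext_eq_refl.
split=> [i|j].
  by have [/(_ (memi i)) [j e] _] := E _ (in_model_mem inf (memi i)); exists j.
have [_ /(_ (memj j)) [i e]] := E _ (in_model_mem inh (memj j)).
by exists i; exact: ext_eq_sym.
Qed.

Lemma mem_nonatom x y : mem_fmc x y -> ~ is_atom y.
Proof. by move=> + [a ya]; rewrite ya. Qed.

Definition upair x y := Coll (fun b : bool => if b then x else y).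
Definition kpair x y := upair (upair x x) (upair x y).

Lemma mem_upair x y z : mem_fmc z (upair x y) <-> ext_eq z x \/ ext_eq z y.
Proof.
split=> [[[] e]|[e|e]]; [by left|by right|by exists true|by exists false].
Qed.

Lemma act_kpair g x y : act g (kpair x y) = kpair (act g x) (act g y).
Proof.
have actU u v : act g (upair u v) = upair (act g u) (act g v).
  by congr Coll; apply: funext => -[].
by rewrite /kpair !actU.
Qed.

Lemma ext_eq_upair x y x' y' : ext_eq x x' -> ext_eq y y' ->
  ext_eq (upair x y) (upair x' y').
Proof.
by move=> xx' yy'; split=> -[];
  [exists true|exists false|exists true|exists false].
Qed.

Lemma ext_eq_kpair x y x' y' : ext_eq x x' -> ext_eq y y' ->
  ext_eq (kpair x y) (kpair x' y').
Proof. by move=> xx' yy'; do !apply: ext_eq_upair. Qed.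

Lemma upair_inj x y z : ext_eq (upair x y) (upair x z) -> ext_eq y z.
Proof.
move=> e.
have /(mem_ext_r e) /mem_upair [yx|//] : mem_fmc y (upair x y).
  by apply/mem_upair; right; exact: ext_eq_refl.
have /(mem_ext_r (ext_eq_sym e)) /mem_upair [zx|] : mem_fmc z (upair x z).
  by apply/mem_upair; right; exact: ext_eq_refl.
  exact: ext_eq_trans yx (ext_eq_sym zx).
exact: ext_eq_sym.
Qed.

Lemma kpair_inj x y x' y' : ext_eq (kpair x y) (kpair x' y') ->
  ext_eq x x' /\ ext_eq y y'.
Proof.
move=> e; have xx' : ext_eq x x'.
  have /(mem_ext_r (ext_eq_sym e)) /mem_upair [] : mem_fmc (upair x' x') (kpair x' y').
  - by apply/mem_upair; left; exact: ext_eq_refl.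
  - move=> e1; apply: ext_eq_sym.
    have /(mem_ext_r e1) /mem_upair [] // : mem_fmc x' (upair x' x').
    by apply/mem_upair; left; exact: ext_eq_refl.
  - move=> e1; have /(mem_ext_r (ext_eq_sym e1)) /mem_upair [] // : mem_fmc x (upair x y).
    by apply/mem_upair; left; exact: ext_eq_refl.
split=> //.
have xx : ext_eq (upair x x) (upair x' x') by exact: ext_eq_upair.
have e2 : ext_eq (kpair x y) (upair (upair x x) (upair x' y')).
  apply: ext_eq_trans e _; apply: ext_eq_upair; last exact: ext_eq_refl.
  exact: ext_eq_sym.
have e3 := upair_inj e2.
apply: (@upair_inj x); apply: ext_eq_trans e3 _.
by apply: ext_eq_upair; [exact: ext_eq_sym|exact: ext_eq_refl].
Qed.

Lemma in_model_upair x y : in_model G x -> in_model G y -> in_model G (upair x y).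
Proof.
move=> inx iny; have [E finE fixE] := in_model_support inx.
have [F finF fixF] := in_model_support iny.
apply: (@supported_in_model (E `|` F)); first by rewrite finite_setU.
  move=> g [Gg gEF].
  have gx : ext_eq (act g x) x by apply: fixE; split=> // a Ea; apply: gEF; left.
  have gy : ext_eq (act g y) y by apply: fixF; split=> // a Fa; apply: gEF; right.
  by split=> -[]; [exists true|exists false|exists true|exists false].
by move=> z /mem_upair [] /ext_eq_sym e; exact: in_model_ext e _.
Qed.

Lemma in_model_kpair x y : in_model G x -> in_model G y -> in_model G (kpair x y).
Proof. by move=> inx iny; do !apply: in_model_upair. Qed.

(** The internal notions quantify over the model only; since the model is
    transitive and closed under pairs, they agree with the external pairs. *)
Lemma is_upairP (p x y : M) :
  is_upair p x y <-> ext_eq (sval p) (upair (sval x) (sval y)).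
Proof.
split=> [H|e z]; last first.
  split=> [/(mem_ext_r e) /mem_upair //|zxy].
  by apply: mem_ext_r (ext_eq_sym e) _; exact/mem_upair.
apply: ext_eqP.
- apply: (@mem_nonatom (sval x)).
  by apply: (H x).2; left; exact: ext_eq_refl.
- by case.
- exact: svalP p.
- by apply: in_model_upair; exact: svalP.
- by move=> z inz; rewrite mem_upair; exact: (H (exist _ z inz)).
Qed.

Lemma is_opairP (p x y : M) :
  is_opair p x y <-> ext_eq (sval p) (kpair (sval x) (sval y)).
Proof.
split=> [[u [v [/is_upairP eu /is_upairP ev /is_upairP ep]]]|e].
  exact: ext_eq_trans ep (ext_eq_upair eu ev).
pose u : M := exist _ _ (in_model_upair (svalP x) (svalP x)).
pose v : M := exist _ _ (in_model_upair (svalP x) (svalP y)).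
by exists u, v; split; apply/is_upairP => //; exact: ext_eq_refl.
Qed.

Lemma mapsP (f x y : M) :
  maps f x y <-> mem_fmc (kpair (sval x) (sval y)) (sval f).
Proof.
split=> [[p [/is_opairP e pf]]|xyf]; first exact: mem_ext_l e pf.
exists (exist _ _ (in_model_kpair (svalP x) (svalP y))).
by split=> //; apply/is_opairP; exact: ext_eq_refl.
Qed.

(** * Natural numbers of the model *)

Definition empty : fmc A := Coll (fun i : False => match i with end).

(** The successor of an atom is a dummy value: only successors of non-atoms are
    used. *)
Definition succ x : fmc A :=
  if x is Coll K f then Coll (fun o : option K => if o is Some i then f i else x)
  else x.
Fixpoint numeral n : fmc A := if n is m.+1 then succ (numeral m) else empty.
Definition numerals : fmc A := Coll numeral.

Lemma numeral_nonatom n : ~ is_atom (numeral n).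
Proof.
elim: n => [[]//|n IH] /=.
by case: (numeral n) IH => [a []|K f _ []//]; exists a.
Qed.

Lemma mem_succ x z : ~ is_atom x -> mem_fmc z (succ x) <-> mem_fmc z x \/ ext_eq z x.
Proof.
case: x => [a []|K f _]; first by exists a.
by split=> [[[i|] e]|[[i e]|e]]; [left; exists i|right|exists (Some i)|exists None].
Qed.

Lemma act_numeral g n : act g (numeral n) = numeral n.
Proof.
have act_succ x : ~ is_atom x -> act g (succ x) = succ (act g x).
  case: x => [a []|K f _]; first by exists a.
  by congr Coll; apply: funext => -[].
elim: n => [|n IH] /=; first by congr Coll; apply: funext.
by rewrite act_succ ?IH //; exact: numeral_nonatom.
Qed.

Lemma in_model_numeral n : in_model G (numeral n).
Proof.
have fixed m g : ext_eq (act g (numeral m)) (numeral m).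
  by rewrite act_numeral; exact: ext_eq_refl.
elim: n => [|n IH].
  by apply: (supported_in_model (finite_set0 _)) => [g _|z [[]]]; exact: (fixed 0).
apply: (supported_in_model (finite_set0 _)) => [g _|z]; first exact: fixed.
move/(mem_succ _ (@numeral_nonatom n)) => [|/ext_eq_sym e].
  exact: in_model_mem.
exact: in_model_ext e IH.
Qed.

Lemma in_model_numerals : in_model G numerals.
Proof.
apply: (supported_in_model (finite_set0 _)) => [g _|z [n /ext_eq_sym e]].
  by split=> n; exists n; rewrite act_numeral; exact: ext_eq_refl.
exact: in_model_ext e (in_model_numeral n).
Qed.

Definition omega : M := exist _ _ in_model_numerals.

Lemma omegaP : is_omega omega.
Proof.
split; first split.
- exists (exist _ _ (in_model_numeral 0)); split; last by exists 0; exact: ext_eq_refl.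
  by split=> [|z [[]]]; exact: numeral_nonatom.
- move=> x [n xn]; exists (exist _ _ (in_model_numeral n.+1)).
  split; last by exists n.+1; exact: ext_eq_refl.
  move=> z /=; split.
    move/(mem_succ _ (@numeral_nonatom n)) => [zn|zn].
      by left; exact: mem_ext_r (ext_eq_sym xn) zn.
    by right; exact: ext_eq_trans zn (ext_eq_sym xn).
  move=> zx; apply/(mem_succ _ (@numeral_nonatom n)).
  case: zx => [zx|zx]; first by left; exact: mem_ext_r xn zx.
  by right; exact: ext_eq_trans zx xn.
- move=> v [[e [[nae emptye] ev]] vsucc] x [n xn].
  suff : mem_fmc (numeral n) (sval v) by exact: mem_ext_l (ext_eq_sym xn).
  elim: n {x xn} => [|n IH].
    apply: (@mem_ext_l (sval e)) ev; apply: ext_eqP.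
    + exact: nae.
    + exact: (@numeral_nonatom 0).
    + exact: svalP e.
    + exact: in_model_numeral 0.
    + by move=> z inz; split=> [ze|[[]]]; case: (emptye (exist _ z inz)).
  have [u [su uv]] := vsucc (exist _ _ (in_model_numeral n)) IH.
  apply: (@mem_ext_l (sval u)) uv; apply: ext_eqP.
  + by apply: (@mem_nonatom (numeral n));
       apply/(su (exist _ _ (in_model_numeral n))); right; exact: ext_eq_refl.
  + exact: (@numeral_nonatom n.+1).
  + exact: svalP u.
  + exact: in_model_numeral n.+1.
  + move=> z inz; split=> [/(su (exist _ z inz)) h|].
      exact/(mem_succ _ (@numeral_nonatom n)).
    by move/(mem_succ _ (@numeral_nonatom n)) => h; exact/(su (exist _ z inz)).
Qed.

(** * Functions defined on the atoms *)

Lemma surjection_onto_omega (F : A -> nat) (E : set A) : finite_set E ->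
  (forall g, fixator G E g -> forall a, F (g a) = F a) ->
  (forall n, exists a, F a = n) ->
  exists f : M, is_surjection f (exist _ _ (atoms_in_model groupG) : M) omega.
Proof.
move=> finE FE surF.
pose f := Coll (fun a => kpair (Atom a) (numeral (F a))).
have inpair a : in_model G (kpair (Atom a) (numeral (F a))).
  by apply: in_model_kpair; [exact: atom_in_model|exact: in_model_numeral].
have inf : in_model G f.
  apply: (supported_in_model finE) => [g gE|z [a /ext_eq_sym e]]; last first.
    exact: in_model_ext e (inpair a).
  have [bij _ _ _] := groupG; have [g' gK g'K] := bij _ gE.1.
  have actE a : act g (kpair (Atom a) (numeral (F a))) =
                kpair (Atom (g a)) (numeral (F (g a))).
    by rewrite act_kpair act_numeral FE.
  split=> a; first by exists (g a); rewrite actE; exact: ext_eq_refl.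
  by exists (g' a); rewrite actE g'K; exact: ext_eq_refl.
exists (exist _ _ inf); split; first split.
- by case.
- move=> p [a pa].
  exists (exist _ _ (atom_in_model a groupG)), (exist _ _ (in_model_numeral (F a))).
  split; [by exists a|by exists (F a); exact: ext_eq_refl|exact/is_opairP].
- move=> x [a xa]; exists (exist _ _ (in_model_numeral (F a))); apply/mapsP.
  by exists a; apply: ext_eq_kpair => //; exact: ext_eq_refl.
- move=> x y z /mapsP [a /kpair_inj [xa ya]] /mapsP [b /kpair_inj [xb zb]].
  have ab : a = b by have := ext_eq_trans (ext_eq_sym xa) xb.
  by apply: ext_eq_trans ya (ext_eq_sym _); rewrite ab.
- move=> y [n yn]; have [a Fa] := surF n.
  exists (exist _ _ (atom_in_model a groupG)); split; first by exists a.
  apply/mapsP; exists a; rewrite Fa; apply: ext_eq_kpair => //; exact: ext_eq_refl.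
Qed.

Lemma surjection_equivariant (f : M) : exists2 E : set A, finite_set E &
  forall g x y, fixator G E g -> mem_fmc (kpair x y) (sval f) ->
    mem_fmc (kpair (act g x) (act g y)) (sval f).
Proof.
have [E finE fixE] := in_model_support (svalP f).
exists E => // g x y gE xyf; rewrite -act_kpair.
exact: mem_ext_r (fixE g gE) (mem_act g xyf).
Qed.

(** A surjection onto a proper superset yields an infinite sequence of iterated
    preimages [u n] of an element that is not an atom.  By equivariance, fixing
    the support [E] and [u N] fixes [u i] for all [i < N]; so [u N] contradicts
    the bound [N]. *)
Lemma Delta5_of_bounded_closure :
  (forall E : set A, finite_set E -> exists N, forall a (u : 'I_N -> A),
     (forall i g, fixator G (a |` E) g -> g (u i) = u i) -> ~ injective u) ->
  Delta5 (exist _ _ (atoms_in_model groupG) : M).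
Proof.
move=> bounded Y [subY [y0 [y0Y y0U]]] [f [[_ _ _ funf] surf]].
have [E finE equif] := surjection_equivariant f.
pose R a b := mem_fmc (kpair (Atom a) (Atom b)) (sval f).
pose at_ a : M := exist _ _ (atom_in_model a groupG).
have Rfun a (y z : M) : mem_fmc (kpair (Atom a) (sval y)) (sval f) ->
    mem_fmc (kpair (Atom a) (sval z)) (sval f) -> ext_eq (sval y) (sval z).
  by move=> ay az; apply: (funf (at_ a)); exact/mapsP.
have pre (y : M) : fm_mem y Y -> exists a, mem_fmc (kpair (Atom a) (sval y)) (sval f).
  move=> /surf [x [[a xa] /mapsP xyf]]; exists a.
  by apply: mem_ext_l xyf; apply: ext_eq_kpair => //; exact: ext_eq_refl.
have [a0 a0P] := pre y0 y0Y.
have [r rP] : exists r : A -> A, forall b, R (r b) b.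
  have /boolp.choice [r rP] : forall b, exists a, R a b; last by exists r.
  by move=> b; apply: (pre (at_ b)); apply: subY; exists b.
pose u n := iter n r a0.
have u_inj : injective u.
  have uN0 n : u n.+1 <> a0.
    move=> E0; apply: y0U; exists (u n).
    by apply: (Rfun a0 y0 (at_ (u n)) a0P); rewrite -{1}E0; exact: rP.
  have pred_eq m n : u m.+1 = u n.+1 -> u m = u n.
    move=> Emn; apply: (Rfun (u m.+1) (at_ (u m)) (at_ (u n)) (rP _)).
    by rewrite Emn; exact: rP.
  elim=> [|m IH] [|n] //; [by move/esym/uN0|by move/uN0|by move/pred_eq/IH ->].
have u_fixed g m k : fixator G E g -> g (u (m + k)%N) = u (m + k)%N -> g (u m) = u m.
  move=> gE; elim: k => [|k IH]; first by rewrite addn0.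
  rewrite addnS => gu; apply: IH.
  apply: (Rfun (u (m + k).+1) (at_ (g (u (m + k)%N))) (at_ (u (m + k)%N))); last exact: rP.
  by rewrite -{1}gu; exact: equif (Atom (r (u (m + k)%N))) (Atom _) gE (rP _).
have [N bN] := bounded E finE.
apply: (bN (u N) (fun i => u i)) => [i g [Gg gfix]|i j /u_inj /val_inj //].
apply: (u_fixed g i (N - i)%N); first by split=> // a Ea; apply: gfix; right.
by rewrite subnKC ?(ltnW (ltn_ord i)) //; apply: gfix; left.
Qed.
End PermutationModelTheory.

(** * Ramification orders *)

Section RamificationOrders.
Context {d : Order.disp_t} {T : porderType d}.
Local Open Scope order_scope.
Local Open Scope card_scope.
Local Open Scope classical_set_scope.
Local Notation down := Defs.down.
Hypothesis treeT : is_tree T.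
Implicit Types (X Y Z : set T) (h : T -> T).

Lemma image_meet h a b : automorphism T h ->
  h @` (down a `&` down b) = down (h a) `&` down (h b).
Proof.
move=> [[h' hK h'K] mh]; apply/seteqP; split=> [_ [y [ya yb] <-]|z [za zb]].
  by split; rewrite /Defs.down /= mh.
by exists (h' z); rewrite ?h'K //; split; rewrite /Defs.down /= -mh h'K.
Qed.

Lemma image_cancel (S S' : Type) (f : S -> S') (g : S' -> S) :
  cancel f g -> cancel (image^~ f) (image^~ g).
Proof. by move=> fK X; rewrite /= image_comp (funext fK : g \o f = id) image_id. Qed.

Lemma image_above h X Y : automorphism T h -> above X Y -> above (h @` X) (h @` Y).
Proof.
move=> ah []; rewrite TplusP // => -[a [b ->]] [XY nXY].
have [[k hK _] _] := ah.
split; first by rewrite TplusP // image_meet //; exists (h a), (h b).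
split; first exact: image_subset.
by move=> /(congr1 (image^~ k)); rewrite !image_cancel.
Qed.

Lemma image_cone_equiv h X Y Z : automorphism T h ->
  cone_equiv X Y Z -> cone_equiv (h @` X) (h @` Y) (h @` Z).
Proof.
move=> ah [S [XS SY SZ]]; exists (h @` S).
by split; [exact: image_above|exact: image_subset|exact: image_subset].
Qed.

(** An automorphism acts on sets of points, hence on cones; the action is
    injective and maps the cones at [X] to cones at the image of [X]. *)
Lemma cones_card_le h X : automorphism T h -> cones X #<= cones (h @` X).
Proof.
move=> ah; have [[k hK kK] _] := ah.
have ak := automorphism_inv ah hK kK.
have imK := image_cancel hK; have imK' := image_cancel kK.
pose Phi (c : set (set T)) := image^~ h @` c.
have Phi_inj : injective Phi := can_inj (image_cancel imK).
have /card_eqPle [_ le] := inj_card_eq (A := cones X) (f := Phi) (in2W Phi_inj).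
apply: card_le_trans le _; apply: subset_card_le.
move=> _ [_ [Y XY <-] <-]; exists (h @` Y); first exact: image_above.
apply/seteqP; split=> [Z [hXZ hYZ]|_ [Z [XZ YZ] <-]].
  exists (k @` Z); last exact: imK'.
  by rewrite -[X]imK -[Y]imK; split; [exact: image_above|exact: image_cone_equiv].
by split; [exact: image_above|exact: image_cone_equiv].
Qed.

Lemma ramification_order_image h X : automorphism T h ->
  ramification_order (h @` X) = ramification_order X.
Proof.
move=> ah; have [[k hK kK] _] := ah.
have ak := automorphism_inv ah hK kK.
have E : cones (h @` X) #= cones X.
  apply/card_eqPle; split; last exact: cones_card_le.
  by rewrite -{2}[X](image_cancel hK); exact: cones_card_le.
by apply/funext => K; rewrite /ramification_order /= (card_eqr E).
Qed.

(** A ramification point is the meet of incomparable points [b] and [c]; an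
    automorphism taking [b] to [a] takes it to a meet with [a] of the same order. *)
Lemma orders_at_meets a O :
  (forall x y : T, exists2 h, automorphism T h & h x = y) ->
  ramification_orders T O -> exists b, O = ramification_order (down a `&` down b).
Proof.
move=> trans [_ [_ [b [c [_ ->]]] <-]].
have [h ah hb] := trans b a.
by exists (h c); rewrite -{1}hb -image_meet // ramification_order_image.
Qed.
End RamificationOrders.

Lemma surjection_onto_nat (S : Type) (B : set S) : infinite_set B ->
  exists phi : S -> nat, forall n, exists2 s, B s & phi s = n.
Proof.
move=> /infiniteP /pcard_geP /surjPex [phi surphi]; exists phi => n.
by have [s Bs <-] := surphi n I; exists s.
Qed.

Theorem theorem3p1 (d : Order.disp_t) (T : porderType d)
    (T_countable : countable [set: T]%classic)
    (T_tree : is_tree T)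
    (T_w2t : weakly_2_transitive T)
    (T_nontrivial : nontrivial_tree T) :
  Delta5 (U_tree T) /\
  (infinite_set (ramification_orders T) -> ~ Delta4 (U_tree T)).
Proof.
have [rat_chains [a _]] := T_nontrivial; split.
  apply: Delta5_of_bounded_closure => E /finite_seqP [l El].
  pose n := (size l).+1; exists (n * n * n.+1).+1 => b u fixu /injectiveP injb.
  have : uniq (codom u) by [].
  move/(@pinned_bounded _ _ T_tree rat_chains T_w2t (b :: l)).
  rewrite size_codom card_ord ltnn => H; suff : false by []; apply: H.
  move=> _ /codomP [i ->] h ah hfix; apply: fixu; split=> // x.
  by rewrite El => -[->|xl]; apply: hfix; rewrite inE ?eqxx // [x \in l]xl orbT.
move=> inf /(_ _ (omegaP (automorphism_group T))); apply.
have [phi surphi] := surjection_onto_nat inf.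
pose F b := phi (ramification_order (Defs.down a `&` Defs.down b)%classic).
apply: (@surjection_onto_omega _ _ _ F [set a]%classic) => [|g [ag ga] b|n].
- exact: finite_set1.
- rewrite /F -{1}(ga a) // -(image_meet _ _ ag).
  by rewrite ramification_order_image.
- have [O OO <-] := surphi n.
  have [b ->] := orders_at_meets T_tree a (automorphism_transitive rat_chains T_w2t) OO.
  by exists b.
Qed.
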